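(* Let $H=\{H_\alpha\}_{\alpha\in\pi}$ be a finite dimensional Hopf $\pi$-coalgebra. Then $H$ is semisimple (i.e. each algebra $H_\alpha$, $\alpha\in\pi$, is semisimple) if and only if the algebra $H_1$ is semisimple.
   Context: Throughout, $\pi$ is a discrete group with neutral element $1$, $\Bbbk$ is a field, $\otimes=\otimes_\Bbbk$, and algebras are associative and unital over $\Bbbk$ (the zero algebra is allowed, and is semisimple). A $\pi$-coalgebra is a family $C=\{C_\alpha\}_{\alpha\in\pi}$ of $\Bbbk$-spaces with $\Bbbk$-linear maps $\Delta_{\alpha,\beta}:C_{\alpha\beta}\to C_\alpha\otimes C_\beta$ and $\epsilon:C_1\to\Bbbk$ such that $(\Delta_{\alpha,\beta}\otimes\mathrm{id}_{C_\gamma})\Delta_{\alpha\beta,\gamma}=(\mathrm{id}_{C_\alpha}\otimes\Delta_{\beta,\gamma})\Delta_{\alpha,\beta\gamma}$ and $(\mathrm{id}_{C_\alpha}\otimes\epsilon)\Delta_{\alpha,1}=\mathrm{id}_{C_\alpha}=(\epsilon\otimes\mathrm{id}_{C_\alpha})\Delta_{1,\alpha}$ for all $\alpha,\beta,\gamma\in\pi$. A Hopf $\pi$-coalgebra is a $\pi$-coalgebra $H=(\{H_\alpha\},\Delta,\epsilon)$ with $\Bbbk$-linear maps $S_\alpha:H_\alpha\to H_{\alpha^{-1}}$ (the antipode) such that each $H_\alpha$ is an algebra with multiplication $m_\alpha$ and unit $1_\alpha$, the maps $\epsilon$ and all $\Delta_{\alpha,\beta}$ are algebra homomorphisms, and $m_\alpha(S_{\alpha^{-1}}\otimes\mathrm{id}_{H_\alpha})\Delta_{\alpha^{-1},\alpha}=\epsilon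 1_\alpha=m_\alpha(\mathrm{id}_{H_\alpha}\otimes S_{\alpha^{-1}})\Delta_{\alpha,\alpha^{-1}}$ for all $\alpha$. $H$ is finite dimensional if every $H_\alpha$ is finite dimensional over $\Bbbk$. *)

(* Defs.v *)
From HB Require Import structures.
From mathcomp Require Import all_boot all_algebra.

Set Implicit Arguments.
Unset Strict Implicit.
Unset Printing Implicit Defensive.

Import GRing.Theory.
Local Open Scope ring_scope.

(* MathComp's [algType] and [falgType] require 1 != 0.  The algebras below    *)
(* may be zero, so their structure is declared on top of [vectType], and the  *)
(* ring operations are obtained through a [pzRingType] instance.              *)
HB.mixin Record Vector_isFdAlgebra (k : fieldType) (A : Type)
    of Vector k A := {
  fdalg_one : A;
  fdalg_mul : A -> A -> A;
  fdalg_mulA : associative fdalg_mul;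
  fdalg_mul1 : left_id fdalg_one fdalg_mul;
  fdalg_mulx1 : right_id fdalg_one fdalg_mul;
  fdalg_mulDl : left_distributive fdalg_mul +%R;
  fdalg_mulDr : right_distributive fdalg_mul +%R;
  fdalg_mulZl : forall (a : k) (x y : A),
    fdalg_mul (a *: x) y = a *: fdalg_mul x y;
  fdalg_mulZr : forall (a : k) (x y : A),
    fdalg_mul x (a *: y) = a *: fdalg_mul x y }.

#[short(type="fdAlgType")]
HB.structure Definition FdAlgebra (k : fieldType) :=
  { A of Vector_isFdAlgebra k A & Vector k A }.

(* The library has no common substructure of [pzRingType] and [vectType], so  *)
(* a concrete algebra needs its [pzRingType] instance declared separately (as *)
(* done for [tens] below), from the same operations.                          *)
#[non_forgetful_inheritance]
HB.instance Definition _ (k : fieldType) (A : fdAlgType k) :=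
  GRing.Zmodule_isPzRing.Build (FdAlgebra.sort A)
    (@fdalg_mulA k A) (@fdalg_mul1 k A) (@fdalg_mulx1 k A)
    (@fdalg_mulDl k A) (@fdalg_mulDr k A).

Section FdAlgebraTheory.
Variables (k : fieldType) (A : fdAlgType k).
Implicit Types (a : k) (x y : A).

Lemma fdalg_scaleAl a x y : a *: x * y = a *: (x * y).
Proof. exact: fdalg_mulZl. Qed.

Lemma fdalg_scaleAr a x y : x * (a *: y) = a *: (x * y).
Proof. exact: fdalg_mulZr. Qed.

End FdAlgebraTheory.

(* Complete reducibility: every submodule is a direct summand.               *)
Definition semisimple_module (R : pzRingType) (M : lmodType R) : Prop :=
  forall N : {pred M}, submod_closed N ->
  exists N' : {pred M},
    [/\ submod_closed N',
        forall x, x \in N -> x \in N' -> x = 0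
      & forall x, exists y z, [/\ y \in N, z \in N' & x = y + z]].

(* R is semisimple as a left module over itself; a submodule of R^o is a left ideal of R. *)
Definition semisimple_ring (R : pzRingType) : Prop :=
  semisimple_module R^o.

Section Tensor.
Variable k : fieldType.

(* A tensor is represented by its coordinates on the products of the vectors  *)
(* of the chosen bases of U and V; [tens_liftE] and [tens_lift_uniq] are the  *)
(* universal property.                                                        *)
Definition tens (U V : vectType k) : Type := 'M[k]_(\dim {:U}, \dim {:V}).

HB.instance Definition _ (U V : vectType k) := Vector.on (tens U V).

Definition tpure (U V : vectType k) (u : U) (v : V) : tens U V :=
  \matrix_(i, j) (coord (vbasis {:U}) i u * coord (vbasis {:V}) j v).

Definition tens_lift (U V W : vectType k) (b : U -> V -> W) (t : tens U V) : W :=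
  \sum_i \sum_j
    (t : 'M_(_, _)) i j *: b (vbasis {:U})`_i (vbasis {:V})`_j.

Definition bilin (U V W : vectType k) (b : U -> V -> W) : Prop :=
  (forall v, linear (b^~ v)) /\ (forall u, linear (b u)).

Section Theory.
Variables U V W : vectType k.

Lemma tpure_bilin : bilin (@tpure U V).
Proof.
split=> [v | u] a x y; apply/matrixP=> i j; rewrite !mxE linearP /=.
  by rewrite mulrDl mulrA.
by rewrite mulrDr !mulrA [_ * a]mulrC.
Qed.

Lemma tens_lift_linear (b : U -> V -> W) : linear (tens_lift b).
Proof.
move=> a s t; rewrite /tens_lift scaler_sumr -big_split /=.
apply: eq_bigr => i _; rewrite scaler_sumr -big_split /=.
by apply: eq_bigr => j _; rewrite !mxE scalerDl scalerA.
Qed.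

HB.instance Definition _ (b : U -> V -> W) :=
  GRing.isLinear.Build k (tens U V) W _ (tens_lift b) (tens_lift_linear b).

Lemma lin_sum (Z : vectType k) (f : Z -> W) (lf : linear f) n
    (c : 'I_n -> k) (e : 'I_n -> Z) :
  f (\sum_i c i *: e i) = \sum_i c i *: f (e i).
Proof.
pose F := GRing.isLinear.Build k Z W _ f lf.
pose g : {linear Z -> W} := HB.pack f F.
by rewrite -[f]/(g : Z -> W) linear_sum; apply: eq_bigr => i _; rewrite linearZ.
Qed.

Lemma tens_liftE (b : U -> V -> W) (u : U) (v : V) :
  bilin b -> tens_lift b (tpure u v) = b u v.
Proof.
case=> bl br; rewrite [in RHS](coord_vbasis (memvf u)) (lin_sum (bl v)).
apply: eq_bigr => i _.
rewrite [in RHS](coord_vbasis (memvf v)) (lin_sum (br _)) scaler_sumr.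
by apply: eq_bigr => j _; rewrite !mxE scalerA.
Qed.

End Theory.

Lemma coord_vbasisE (U : vectType k) (i j : 'I_(\dim {:U})) :
  coord (vbasis {:U}) i (vbasis {:U})`_j = (j == i)%:R.
Proof. exact: coord_free (basis_free (vbasisP _)). Qed.

Lemma tens_lift_id (U V : vectType k) (t : tens U V) :
  tens_lift (@tpure U V) t = t.
Proof.
apply/matrixP=> p q; rewrite /tens_lift summxE (bigD1 p) //= summxE.
rewrite (bigD1 q) //= !mxE !coord_vbasisE !eqxx !mulr1 !big1 ?addr0 //.
  move=> i ip; rewrite summxE big1 // => j _.
  by rewrite !mxE !coord_vbasisE (negPf ip) mul0r mulr0.
move=> j jq.
by rewrite !mxE !coord_vbasisE (negPf jq) !mulr0.
Qed.

Lemma tens_lift_uniq (U V W : vectType k) (f : tens U V -> W) :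
  linear f -> forall t, f t = tens_lift (fun u v => f (tpure u v)) t.
Proof.
move=> lf t.
pose F := GRing.isLinear.Build k (tens U V) W _ f lf.
pose g : {linear tens U V -> W} := HB.pack f F.
rewrite -{1}[t]tens_lift_id -[f]/(g : tens U V -> W) linear_sum.
apply: eq_bigr => i _.
by rewrite linear_sum; apply: eq_bigr => j _; rewrite linearZ.
Qed.

Lemma tens_ext (U V W : vectType k) (f g : tens U V -> W) :
  linear f -> linear g ->
  (forall u v, f (tpure u v) = g (tpure u v)) -> f =1 g.
Proof.
move=> lf lg fg t; rewrite (tens_lift_uniq lf) (tens_lift_uniq lg).
by apply: eq_bigr => i _; apply: eq_bigr => j _; rewrite fg.
Qed.

Lemma tens_lift_linear_param (U V W Z : vectType k) (F : Z -> U -> V -> W)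
    (t : tens U V) :
  (forall u v, linear (fun z => F z u v)) ->
  linear (fun z => tens_lift (F z) t).
Proof.
move=> lF a x y; rewrite /tens_lift scaler_sumr -big_split /=.
apply: eq_bigr => i _; rewrite scaler_sumr -big_split /=.
apply: eq_bigr => j _; rewrite lF scalerDr !scalerA.
by rewrite [_ * a]mulrC.
Qed.

(* f (x) g, for linear maps f and g *)
Definition tens_map (U U' V V' : vectType k) (f : U -> U') (g : V -> V') :
    tens U V -> tens U' V' :=
  tens_lift (fun u v => tpure (f u) (g v)).

(* (u (x) v) (x) w |-> u (x) (v (x) w) *)
Definition tens_assoc (U V W : vectType k) :
    tens (tens U V) W -> tens U (tens V W) :=
  tens_lift (fun t w => tens_lift (fun u v => tpure u (tpure v w)) t).

End Tensor.

Section TensorAlgebra.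
Variables (k : fieldType) (A B : fdAlgType k).
Implicit Types r s t : tens A B.

Definition tens_one : tens A B := tpure (1 : A) (1 : B).

(* (a (x) b) (a' (x) b') = a a' (x) b b' *)
Definition tens_mul s t : tens A B :=
  tens_lift (fun (a : A) (b : B) =>
    tens_lift (fun (a' : A) (b' : B) =>
      tpure (a * a' : A) (b * b' : B)) t) s.

Let bilin_in a b :
  bilin (fun (a' : A) (b' : B) => tpure (a * a' : A) (b * b' : B)).
Proof.
split=> [b' | a'] c x y; rewrite mulrDr fdalg_scaleAr.
  exact: (tpure_bilin _ _).1.
exact: (tpure_bilin _ _).2.
Qed.

Let bilin_out t :
  bilin (fun (a : A) (b : B) =>
    tens_lift (fun (a' : A) (b' : B) =>
      tpure (a * a' : A) (b * b' : B)) t).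
Proof.
split=> [b | a]; apply: tens_lift_linear_param => a' b' c x y;
  rewrite mulrDl fdalg_scaleAl.
  exact: (tpure_bilin _ _).1.
exact: (tpure_bilin _ _).2.
Qed.

Lemma tens_mul_linl t : linear (tens_mul^~ t).
Proof. exact: tens_lift_linear. Qed.

Lemma tens_mul_linr s : linear (tens_mul s).
Proof. by apply: tens_lift_linear_param => a b; apply: tens_lift_linear. Qed.

Lemma tens_mul_pure (a a' : A) (b b' : B) :
  tens_mul (tpure a b) (tpure a' b') = tpure (a * a' : A) (b * b' : B).
Proof.
rewrite /tens_mul (tens_liftE _ _ (bilin_out _)).
by rewrite (tens_liftE _ _ (bilin_in _ _)).
Qed.

Fact tens_mulDl : left_distributive tens_mul +%R.
Proof. by move=> x y t; have := tens_mul_linl t 1 x y; rewrite !scale1r. Qed.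

Fact tens_mulDr : right_distributive tens_mul +%R.
Proof. by move=> s x y; have := tens_mul_linr s 1 x y; rewrite !scale1r. Qed.

Fact tens_mul0l t : tens_mul 0 t = 0.
Proof. by apply: (addrI (tens_mul 0 t)); rewrite -tens_mulDl !addr0. Qed.

Fact tens_mul0r s : tens_mul s 0 = 0.
Proof. by apply: (addrI (tens_mul s 0)); rewrite -tens_mulDr !addr0. Qed.

Fact tens_mulZl (c : k) s t : tens_mul (c *: s) t = c *: tens_mul s t.
Proof. by have := tens_mul_linl t c s 0; rewrite tens_mul0l !addr0. Qed.

Fact tens_mulZr (c : k) s t : tens_mul s (c *: t) = c *: tens_mul s t.
Proof. by have := tens_mul_linr s c t 0; rewrite tens_mul0r !addr0. Qed.

Fact tens_mulA : associative tens_mul.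
Proof.
move=> r s t; move: r; apply: tens_ext => [c x y|c x y|a b].
- by rewrite tens_mul_linl.
- by rewrite !tens_mul_linl.
move: s; apply: tens_ext => [c x y|c x y|a' b'].
- by rewrite tens_mul_linl tens_mul_linr.
- by rewrite tens_mul_linr tens_mul_linl.
move: t; apply: tens_ext => [c x y|c x y|a'' b''].
- by rewrite !tens_mul_linr.
- by rewrite tens_mul_linr.
by rewrite !tens_mul_pure !mulrA.
Qed.

Fact tens_mul1 : left_id tens_one tens_mul.
Proof.
apply: tens_ext => [c x y|//|a b]; first by rewrite tens_mul_linr.
by rewrite tens_mul_pure !mul1r.
Qed.

Fact tens_mulx1 : right_id tens_one tens_mul.
Proof.
apply: tens_ext => [c x y|//|a b]; first by rewrite tens_mul_linl.
by rewrite tens_mul_pure !mulr1.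
Qed.

HB.instance Definition _ :=
  Vector_isFdAlgebra.Build k (tens A B) tens_mulA tens_mul1 tens_mulx1
    tens_mulDl tens_mulDr tens_mulZl tens_mulZr.

HB.instance Definition _ :=
  GRing.Zmodule_isPzRing.Build (tens A B) tens_mulA tens_mul1 tens_mulx1
    tens_mulDl tens_mulDr.

End TensorAlgebra.

(* the multiplication of A as a map A (x) A -> A *)
Definition tens_contract (k : fieldType) (A : fdAlgType k) (t : tens A A) : A :=
  tens_lift (fun x y : A => x * y : A) t.

Section HopfGroupCoalgebra.
Variable pi : groupType.

(* Group laws hold only propositionally, so that e.g. H (1 * a) and H a are   *)
(* distinct types; [transp] is the identification of equal-index components.  *)
Definition transp (H : pi -> Type) (a b : pi) (e : a = b) (x : H a) : H b :=
  eq_rect a H x b e.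

Variable k : fieldType.

Definition pi_coalgebra (C : pi -> vectType k)
    (D : forall a b : pi, {linear C (a * b)%g -> tens (C a) (C b)})
    (eps : {scalar C 1%g}) : Prop :=
  [/\ forall (a b c : pi) (x : C (a * (b * c))%g),
        tens_assoc (tens_map (D a b) (@id (C c))
          (D (a * b)%g c (transp (H := C) (mulgA a b c) x)))
        = tens_map (@id (C a)) (D b c) (D a (b * c)%g x),
      (* C a (x) k is identified with C a through x (x) l |-> l x *)
      forall (a : pi) (x : C a),
        tens_lift (fun y z => eps z *: y)
          (D a 1%g (transp (H := C) (esym (mulg1 a)) x)) = x
    & forall (a : pi) (x : C a),
        tens_lift (fun y z => eps y *: z)
          (D 1%g a (transp (H := C) (esym (mul1g a)) x)) = x].

(* Finite dimensionality is part of [fdAlgType].                              *)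
Record hopf_pi_coalgebra := HopfPiCoalgebra {
  hopf_comp :> pi -> fdAlgType k;
  comult : forall a b : pi,
    {linear hopf_comp (a * b)%g -> tens (hopf_comp a) (hopf_comp b)};
  counit : {scalar hopf_comp 1%g};
  antipode : forall a : pi, {linear hopf_comp a -> hopf_comp a^-1%g};
  hopf_pi_coalgebraP :
    pi_coalgebra (C := fun a => hopf_comp a) comult counit;
  comult_morph : forall a b : pi, monoid_morphism (comult a b);
  counit_morph : monoid_morphism counit;
  antipodeL : forall (a : pi) (x : hopf_comp 1%g),
    tens_contract
      (tens_map
        (fun y => transp (H := hopf_comp) (invgK a) (antipode a^-1%g y))
        (@id (hopf_comp a))
        (comult a^-1%g a (transp (H := hopf_comp) (esym (mulVg a)) x)))
    = counit x *: (1 : hopf_comp a);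
  antipodeR : forall (a : pi) (x : hopf_comp 1%g),
    tens_contract
      (tens_map
        (@id (hopf_comp a))
        (fun y => transp (H := hopf_comp) (invgK a) (antipode a^-1%g y))
        (comult a a^-1%g (transp (H := hopf_comp) (esym (mulgV a)) x)))
    = counit x *: (1 : hopf_comp a)
}.

Definition semisimple_hopf (H : hopf_pi_coalgebra) : Prop :=
  forall a : pi, semisimple_ring (H a).

End HopfGroupCoalgebra.

(* Main.v *)
From HB Require Import structures.
Require Import Defs.
From mathcomp Require Import all_boot all_algebra.
From Stdlib Require Import Classical_Prop.

(** If [H 1] is semisimple, a complement of the left ideal ker eps contains an
    element L with eps L = 1, and g L = eps(g) L for all g.  Write
    L_1 (x) L_2 for the coproduct of L in [H a (x) H a^-1].  Maschke's
    averaging applies over every [H a]: if p is a k-linear projection onto a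
    left ideal N of [H a], then P x = sum L_1 p(S(L_2) x) is again a projection
    onto N, and ker P is a left ideal.  That P is [H a]-linear reduces to
    sum S(h_1 y) h_2 = eps(h) S(y) for h in [H 1], which follows from
    sum S(h_1 y_1) h_2 y_2 S(y_3) = eps(h) S(y) and spares us proving that S
    is antimultiplicative. *)

Set Implicit Arguments.
Unset Strict Implicit.
Unset Printing Implicit Defensive.

Import GRing.Theory.
Local Open Scope ring_scope.

(** * Sums over the components of a tensor *)

Section TensLift.
Variable k : fieldType.

(* [tens_lift b t] plays the role of Sweedler's notation: if t = sum t_1 (x) t_2,
   it stands for sum b t_1 t_2. *)
Lemma eq_tens_lift (U V W : vectType k) (b b' : U -> V -> W) (t : tens U V) :
  (forall u v, b u v = b' u v) -> tens_lift b t = tens_lift b' t.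
Proof. by move=> e; apply: eq_bigr => i _; apply: eq_bigr => j _; rewrite e. Qed.

Lemma linear_tens_lift (U V W Z : vectType k) (f : W -> Z) (b : U -> V -> W)
    (t : tens U V) :
  linear f -> f (tens_lift b t) = tens_lift (fun u v => f (b u v)) t.
Proof.
move=> lf; pose F := GRing.isLinear.Build k W Z _ f lf.
pose g : {linear W -> Z} := HB.pack f F.
rewrite -[f]/(g : W -> Z) linear_sum; apply: eq_bigr => i _.
by rewrite linear_sum; apply: eq_bigr => j _; rewrite linearZ.
Qed.

Lemma tens_lift_exchange (U V U' V' W : vectType k)
    (b : U -> V -> U' -> V' -> W) (t : tens U V) (s : tens U' V') :
  tens_lift (fun u v => tens_lift (b u v) s) t
  = tens_lift (fun u' v' => tens_lift (fun u v => b u v u' v') t) s.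
Proof.
rewrite /tens_lift !pair_big /=.
under eq_bigr do rewrite pair_big scaler_sumr.
under [RHS]eq_bigr do rewrite pair_big scaler_sumr.
rewrite exchange_big; apply: eq_bigr => p _; apply: eq_bigr => q _ /=.
by rewrite !scalerA mulrC.
Qed.

End TensLift.

Lemma linear_scale (k : fieldType) (U W : vectType k) (f : U -> W) :
  linear f -> forall c x, f (c *: x) = c *: f x.
Proof.
move=> lf c x; pose F := GRing.isLinear.Build k U W _ f lf.
by pose g : {linear U -> W} := HB.pack f F; rewrite -[f]/(g : U -> W) linearZ.
Qed.

Section FdAlgebraMul.
Variables (k : fieldType) (A : fdAlgType k).

Lemma mulr_linear (x : A) : linear (fun y : A => x * y : A).
Proof. by move=> l y z; rewrite mulrDr fdalg_scaleAr. Qed.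

Lemma mull_linear (x : A) : linear (fun y : A => y * x : A).
Proof. by move=> l y z; rewrite mulrDl fdalg_scaleAl. Qed.

Lemma mul_bilin : bilin (fun x y : A => x * y : A).
Proof. by split; [apply: mull_linear | apply: mulr_linear]. Qed.

End FdAlgebraMul.

(** * Structure maps at propositionally equal indices *)

Section Hopf.
Variables (pi : groupType) (k : fieldType) (H : hopf_pi_coalgebra pi k).
Implicit Types a b c : pi.

Lemma transp_trans a b c (e1 : a = b) (e2 : b = c) (e3 : a = c) (x : H a) :
  transp (H := hopf_comp H) e2 (transp (H := hopf_comp H) e1 x)
  = transp (H := hopf_comp H) e3 x.
Proof. by subst b c; rewrite (eq_irrelevance e3 erefl). Qed.

(* Indices related by an arbitrary proof of equality: as [pi] has decidable
   equality, the choice of proof is irrelevant, and no [transp] is left to be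
   moved around in the Sweedler calculus. *)
Definition comult_at a b c (e : c = (a * b)%g) (x : H c) : tens (H a) (H b) :=
  comult H a b (transp (H := hopf_comp H) e x).

Definition antipode_at a b (e : (b^-1)%g = a) (x : H b) : H a :=
  transp (H := hopf_comp H) e (antipode H b x).

Lemma comult_at_linear a b c (e : c = (a * b)%g) : linear (comult_at e).
Proof. by subst c => l x y; rewrite /comult_at /= linearP. Qed.

Lemma antipode_at_linear a b (e : (b^-1)%g = a) : linear (antipode_at e).
Proof. by subst a => l x y; rewrite /antipode_at /= linearP. Qed.

Lemma comult_atM a b c (e : c = (a * b)%g) (x y : H c) :
  comult_at e (x * y) = comult_at e x * comult_at e y.
Proof. by subst c; rewrite /comult_at /=; have [_ ->] := comult_morph H a b. Qed.

Lemma comult_at_lift a b c (e : c = (a * b)%g) (W : vectType k)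
    (f : H a -> H b -> W) (x y : H c) : bilin f ->
  tens_lift f (comult_at e (x * y)) =
  tens_lift (fun (x1 : H a) (x2 : H b) =>
    tens_lift (fun (y1 : H a) (y2 : H b) => f (x1 * y1) (x2 * y2))
      (comult_at e y))
    (comult_at e x).
Proof.
move=> bf; rewrite comult_atM.
rewrite (linear_tens_lift _ _ (tens_lift_linear f)); apply: eq_tens_lift => u v.
rewrite (linear_tens_lift _ _ (tens_lift_linear f)); apply: eq_tens_lift => u' v'.
exact: tens_liftE.
Qed.

Lemma antipode_atL a b (e : (b^-1)%g = a) (e1 : 1%g = (b * a)%g) (x : H 1%g) :
  tens_lift (fun y (z : H a) => antipode_at e y * z) (comult_at e1 x)
  = counit H x *: (1 : H a).
Proof.
have eb : b = (a^-1)%g by rewrite -e invgK.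
subst b; rewrite (eq_irrelevance e (invgK a)).
rewrite (eq_irrelevance e1 (esym (mulVg a))) -antipodeL.
rewrite /tens_contract /tens_map.
rewrite (linear_tens_lift _ _ (tens_lift_linear _)); apply: eq_tens_lift => u v.
by rewrite tens_liftE //; apply: mul_bilin.
Qed.

Lemma antipode_atR a b (e : (b^-1)%g = a) (e1 : 1%g = (a * b)%g) (x : H 1%g) :
  tens_lift (fun (y : H a) z => y * antipode_at e z) (comult_at e1 x)
  = counit H x *: (1 : H a).
Proof.
(* Solving [e] for [b] permits substitution; the index proofs then agree with those in the axiom by
   irrelevance. *)
have eb : b = (a^-1)%g by rewrite -e invgK.
subst b; rewrite (eq_irrelevance e (invgK a)).
rewrite (eq_irrelevance e1 (esym (mulgV a))) -antipodeR.
rewrite /tens_contract /tens_map.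
rewrite (linear_tens_lift _ _ (tens_lift_linear _)); apply: eq_tens_lift => u v.
by rewrite tens_liftE //; apply: mul_bilin.
Qed.

Lemma counitM (x y : H 1%g) : counit H (x * y) = counit H x * counit H y.
Proof. by case: (counit_morph H) => _ ->. Qed.

Lemma counit_atR a (e : a = (a * 1)%g) (x : H a) :
  tens_lift (fun y z => counit H z *: y) (comult_at e x) = x.
Proof.
rewrite (eq_irrelevance e (esym (mulg1 a))).
by have [_ cR _] := hopf_pi_coalgebraP H; apply: cR.
Qed.

Lemma counit_atL a (e : a = (1 * a)%g) (x : H a) :
  tens_lift (fun y z => counit H y *: z) (comult_at e x) = x.
Proof.
rewrite (eq_irrelevance e (esym (mul1g a))).
by have [_ _ cL] := hopf_pi_coalgebraP H; apply: cL.
Qed.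

Definition trilin (U V W Z : vectType k) (f : U -> V -> W -> Z) : Prop :=
  (forall v w, linear (fun u => f u v w)) /\ (forall u, bilin (f u)).

(** The linear map induced by [f] on the triple tensor product is applied to the coassociativity
    axiom, so that later arguments only regroup sums. *)
Lemma comult_at_coassoc a b c ab bc abc (e1 : ab = (a * b)%g)
    (e2 : abc = (ab * c)%g) (e3 : bc = (b * c)%g) (e4 : abc = (a * bc)%g)
    (W : vectType k) (f : H a -> H b -> H c -> W) (x : H abc) :
  trilin f ->
  tens_lift (fun t z => tens_lift (fun u v => f u v z) (comult_at e1 t))
    (comult_at e2 x)
  = tens_lift (fun u t => tens_lift (fun v z => f u v z) (comult_at e3 t))
    (comult_at e4 x).
Proof.
move=> [lf bf]; subst ab bc abc.
have [coa _ _] := hopf_pi_coalgebraP H.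
(* The axiom takes its argument at index [a * (b * c)]; transporting [y] back along [mulgA] recovers
   [x]. *)
pose y : H (a * (b * c))%g := transp (H := hopf_comp H) e4 x.
have := coa a b c y.
have -> : transp (H := hopf_comp H) (mulgA a b c) y = x.
  exact: (transp_trans e4 (mulgA a b c) erefl).
have bF : bilin (fun u s => tens_lift (f u) s).
  split=> [s | u]; last exact: tens_lift_linear.
  exact: tens_lift_linear_param.
move/(congr1 (tens_lift (fun u s => tens_lift (f u) s))).
rewrite /tens_map.
rewrite [RHS](linear_tens_lift _ _ (tens_lift_linear _)).
rewrite [RHS](eq_tens_lift _ (fun u v => tens_liftE _ _ bF)) => <-.
rewrite /tens_assoc.
rewrite (linear_tens_lift _ _ (tens_lift_linear _)).
rewrite (linear_tens_lift _ _ (tens_lift_linear _)).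
rewrite /comult_at /=; apply: eq_tens_lift => t z.
rewrite tens_liftE; last first.
  split=> [w|s] l w1 w2; first by rewrite !tens_lift_linear.
  rewrite -tens_lift_linear; congr tens_lift; move: l w1 w2.
  apply: tens_lift_linear_param => u v l w1 w2.
  by rewrite (tpure_bilin _ _).2 (tpure_bilin _ _).2.
rewrite (linear_tens_lift _ _ (tens_lift_linear _)).
apply: eq_tens_lift => u v.
by rewrite tens_liftE // tens_liftE.
Qed.

(** The sum of S(h_1 y_1) h_2 y_2 S(y_3) is evaluated in two ways. Contracting y_2 S(y_3) leaves the
    left side. Grouping y_1 and y_2 as the coproduct of some t in [H 1] turns S(h_1 y_1) h_2 y_2
    into eps(h t), by the antipode axiom for h t. *)
Lemma antipode_atM_counit a b (e : (b^-1)%g = a) (e1 : 1%g = (b * a)%g)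
    (h : H 1%g) (y : H b) :
  tens_lift (fun (h1 : H b) (h2 : H a) => antipode_at e (h1 * y) * h2)
    (comult_at e1 h)
  = counit H h *: antipode_at e y.
Proof.
have e2 : 1%g = (a * b)%g by rewrite -e mulVg.
pose S := antipode_at e; have lS : linear S := antipode_at_linear e.
pose g (z : H b) : H a :=
  tens_lift (fun (h1 : H b) (h2 : H a) => S (h1 * z) * h2) (comult_at e1 h).
have lg : linear g.
  apply: tens_lift_linear_param => u v l z z'.
  by rewrite mulr_linear lS mull_linear.
pose f (y1 : H b) (y2 : H a) (y3 : H b) : H a := g y1 * (y2 * S y3).
have tf : trilin f.
  split=> [v w l z z' | u]; first by rewrite /f lg mull_linear.
  split=> [w | v] l z z'; first by rewrite /f mull_linear mulr_linear.
  by rewrite /f lS !mulr_linear.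
have := comult_at_coassoc e1 (esym (mul1g b)) e2 (esym (mulg1 b)) y tf.
rewrite [RHS](eq_tens_lift (b' := fun y1 t => g (counit H t *: y1))); last first.
  move=> y1 t; rewrite -(linear_tens_lift _ _ (mulr_linear (g y1))).
  by rewrite antipode_atR fdalg_scaleAr mulr1 (linear_scale lg).
rewrite -(linear_tens_lift _ _ lg) counit_atR -/(g y) => <-.
have lcS : linear (fun z => counit H h *: S z).
  by move=> l z z'; rewrite lS scalerDr !scalerA mulrC.
rewrite (eq_tens_lift (b' := fun t y3 => counit H h *: S (counit H t *: y3))).
  by rewrite -(linear_tens_lift _ _ lcS) counit_atL.
move=> t y3; rewrite (linear_scale lS) scalerA -counitM.
rewrite -[S y3 in RHS]mul1r -fdalg_scaleAl -(antipode_atL e e1).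
rewrite (comult_at_lift _ _ _ (f := fun u (v : H a) => S u * v)); last first.
  split=> [v | u] l z z'; first by rewrite lS mull_linear.
  exact: mulr_linear.
rewrite tens_lift_exchange (linear_tens_lift _ _ (mull_linear (S y3))).
apply: eq_tens_lift => y1 y2.
rewrite /f /g !(linear_tens_lift _ _ (mull_linear _)).
by apply: eq_tens_lift => h1 h2; rewrite !mulrA.
Qed.

(** * Maschke averaging *)

Definition average a (L : H 1%g) (p : H a -> H a) (x : H a) : H a :=
  tens_lift (fun (u : H a) v => u * p (antipode_at (invgK a) v * x))
    (comult_at (esym (mulgV a)) L).

Lemma average_linear a (L : H 1%g) (p : H a -> H a) :
  linear p -> linear (average L p).
Proof.
move=> lp; apply: tens_lift_linear_param => u v l x y.
by rewrite mulr_linear lp mulr_linear.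
Qed.

(** The sum of h_1 L_1 p(S(h_2 L_2) h_3 x) is grouped in two ways. With h_1, h_2 together, L is
    multiplied by an element of [H 1], which the integral property turns into a scalar, giving P(h
    x). With h_2, h_3 together, [antipode_atM_counit] removes them, giving h P(x). *)
Lemma average_mul a (L : H 1%g) (p : H a -> H a) (h x : H a) :
    linear p -> (forall g : H 1%g, g * L = counit H g *: L) ->
  average L p (h * x) = h * average L p x.
Proof.
move=> lp intL; pose S := antipode_at (invgK a).
have lS : linear S := antipode_at_linear (invgK a).
pose eV := esym (mulgV a).
pose f (h1 : H a) (h2 : H a^-1%g) (h3 : H a) : H a :=
  tens_lift (fun (u : H a) (v : H a^-1%g) =>
    h1 * u * p (S (h2 * v) * (h3 * x))) (comult_at eV L).
have tf : trilin f.
  split=> [h2 h3 | h1]; [|split=> [h3 | h2]];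
    apply: tens_lift_linear_param => u v l z z'.
  - by rewrite !mull_linear.
  - by rewrite mull_linear lS mull_linear lp mulr_linear.
  by rewrite mull_linear mulr_linear lp mulr_linear.
have := comult_at_coassoc eV (esym (mul1g a)) (esym (mulVg a))
  (esym (mulg1 a)) h tf.
have lA : linear (fun z : H a => average L p (z * x)).
  by move=> l z z'; rewrite mull_linear average_linear.
rewrite (eq_tens_lift (b' :=
  fun g (z : H a) => average L p (counit H g *: z * x))).
  rewrite -(linear_tens_lift _ _ lA) counit_atL => ->.
  rewrite (eq_tens_lift (b' :=
    fun (h1 : H a) g => counit H g *: h1 * average L p x)).
    by rewrite -(linear_tens_lift _ _ (mull_linear _)) counit_atR.
  move=> h1 g; rewrite /f tens_lift_exchange fdalg_scaleAl -fdalg_scaleAr.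
  rewrite -(linear_scale (average_linear L lp)).
  rewrite (linear_tens_lift _ _ (mulr_linear _)); apply: eq_tens_lift => u v.
  have lup : linear (fun z : H a => h1 * u * p (z * x)).
    by move=> l z z'; rewrite mull_linear lp mulr_linear.
  rewrite (eq_tens_lift (b' :=
    fun (h2 : H a^-1%g) (h3 : H a) => h1 * u * p (S (h2 * v) * h3 * x))).
    rewrite -(linear_tens_lift _ _ lup) antipode_atM_counit.
    by rewrite fdalg_scaleAl fdalg_scaleAr mulrA.
  by move=> h2 h3; rewrite mulrA.
(* First grouping: the coproducts of g and L multiply to that of g L = eps(g) L. *)
move=> g z; rewrite fdalg_scaleAl (linear_scale (average_linear L lp)).
have bu : bilin (fun (u : H a) v => u * p (S v * (z * x))).
  split=> [v | u] l y y'; first exact: mull_linear.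
  by rewrite lS mull_linear lp mulr_linear.
rewrite /average -/S -/eV -(linear_scale (tens_lift_linear _)).
rewrite -(linear_scale (comult_at_linear eV)) -intL.
by rewrite (comult_at_lift _ _ _ bu).
Qed.

(** * An integral from semisimplicity of [H 1] *)

Lemma counital_integral :
  semisimple_ring (H 1%g) ->
  exists2 L : H 1%g, counit H L = 1 & forall g, g * L = counit H g *: L.
Proof.
move=> ss; pose N : {pred (H 1%g)^o} := [pred x : H 1%g | counit H x == 0].
have sN : submod_closed N.
  split=> [|c x y]; rewrite !inE ?linear0 //.
  move=> /eqP x0 /eqP y0.
  by rewrite linearD /= counitM x0 y0 mulr0 addr0.
have [N' [sN' NN' /(_ 1)[y [z [Ny N'z y1]]]]] := ss N sN.
have y0 : counit H y = 0 by apply/eqP.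
have z1 : counit H z = 1.
  have [<- _] := counit_morph H.
  by rewrite y1 linearD /= y0 add0r.
(* The element g z - eps(g) z is killed by eps because eps(z) = 1, and equals (g - eps(g) 1) z,
   hence lies in the complement [N'] too; so it vanishes. *)
exists z => // g; apply/eqP; rewrite -subr_eq0; apply/eqP.
apply: NN'.
  by rewrite !inE linearB /= counitM linearZ /= z1 mulr1 subrr.
rewrite -[counit H g *: z]mul1r fdalg_scaleAr -fdalg_scaleAl -mulrBl.
have := sN'.2 (g - counit H g *: (1 : H 1%g) : H 1%g) z 0 N'z sN'.1.
by rewrite addr0.
Qed.

End Hopf.

(* Excluded middle is needed to decide whether a vector of N lies outside U:
   [N] is a boolean predicate, but V may be infinite. *)
Lemma subspace_vspace (k : fieldType) (V : vectType k) (N : {pred V}) :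
  submod_closed N -> exists U : {vspace V}, U =i N.
Proof.
move=> sN.
(* Subspaces inside [N] are enlarged one vector at a time until one equals [N]; taking n above the
   dimension of V rules out the second alternative. *)
have step n : (exists U : {vspace V}, U =i N) \/
    exists2 U : {vspace V}, {subset U <= N} & (n <= \dim U)%N.
  elim: n => [|n [|[U UN nU]]]; [|by left|].
    by right; exists 0%VS => // x; rewrite memv0 => /eqP->; case: sN.
  have [[x Nx Ux] | NU] := classic (exists2 x, x \in N & x \notin U).
    right; exists (U + <[x]>)%VS.
      move=> _ /memv_addP[u Uu [_ /vlineP[c ->] ->]].
      by rewrite addrC; apply: sN.2 => //; apply: UN.
    apply: leq_ltn_trans nU _; rewrite ltn_neqAle dimvS ?addvSl // andbT.
    rewrite (dimv_leqif_eq (addvSl U <[x]>)).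
    apply: contra Ux => /eqP->; exact: subvP (addvSr _ _) _ (memv_line x).
  left; exists U => x; apply/idP/idP => [/UN // | Nx].
  by apply/negPn/negP => Ux; case: NU; exists x.
have [//|[U _]] := step (\dim {:V}).+1.
by rewrite ltnNge dimvS ?subvf.
Qed.

Theorem lemma11 (pi : groupType) (k : fieldType) (H : hopf_pi_coalgebra pi k) :
  semisimple_hopf H <-> semisimple_ring (H 1%g).
Proof.
split=> [ss | ss1 a N sN]; first exact: ss.
have [L eL intL] := counital_integral ss1.
have NM (h x : H a) : x \in N -> h * x \in N.
  by move=> Nx; have := sN.2 h x 0 Nx sN.1; rewrite addr0.
(* A left ideal is stable under scalars since c x = (c 1) x, so a linear projection onto it is
   available. *)
have [U UN] : exists U : {vspace H a}, U =i N.
  apply: subspace_vspace; split=> [|c x y Nx Ny]; first exact: sN.1.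
  rewrite -[x]mul1r -fdalg_scaleAl.
  exact: (sN.2 (c *: (1 : H a) : H a) x y Nx Ny).
pose p : {linear H a -> H a} := projv U.
have pid x : x \in N -> p x = x by rewrite -UN; apply: projv_id.
have lp : linear p by apply: linearP.
pose P := average L p.
have lP : linear P := average_linear L lp.
have PN x : P x \in N.
  rewrite -UN; apply: memv_suml => i _; apply: memv_suml => j _.
  by rewrite memvZ // UN NM // -UN memv_proj.
(* On [N] the projection [p] drops out, because S(L_2) x is already in [N]; what remains is (sum L_1
   S(L_2)) x = eps(L) x = x. *)
have Pid x : x \in N -> P x = x.
  have := antipode_atR (invgK a) (esym (mulgV a)) L; rewrite eL scale1r => S1 Nx.
  rewrite -[RHS]mul1r -S1 (linear_tens_lift _ _ (mull_linear x)).
  by apply: eq_tens_lift => u v; rewrite pid ?mulrA // NM.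
have P0 : P 0 = 0 by apply: Pid; exact: sN.1.
pose K : {pred (H a)^o} := [pred x : H a | P x == 0].
exists K; split.
- split=> [|h x y]; rewrite !inE ?P0 // => /eqP Px /eqP Py.
  have := lP 1 (h * x) y; rewrite !scale1r => ->.
  by rewrite /P average_mul // -/P Px Py mulr0 addr0.
- by move=> x Nx; rewrite inE Pid // => /eqP.
(* [P] is idempotent, as its values lie in [N], where it is the identity; so x - P x is in its
   kernel. *)
move=> x; exists (P x), (x - P x); split; rewrite ?inE //; last first.
  by rewrite addrC subrK.
have := lP (-1) (P x) x; rewrite !scaleN1r (Pid (P x)) // => PE.
by rewrite [x - P x]addrC PE addNr.
Qed.
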